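(* For all positive integers $c,d$ with $\mathrm{lcm}(c,d)\le n$, there exist functions $f,g:\{0,1\}^n\to\{0,1\}$ computed by NUOBDDs of width $c$ and $d$, respectively, such that every NUOBDD computing $f\cap g$ (defined by $(f\cap g)(\sigma)=f(\sigma)\wedge g(\sigma)$) has width at least $\mathrm{lcm}(c,d)$.
   Context: A unitary OBDD (UOBDD) of width $d$ on $n$ variables is $(Q,|\psi^0\rangle,T,Q_{acc})$: $Q=\{q_1,\dots,q_d\}$ indexes an orthonormal basis of $\mathbb{C}^d$, $|\psi^0\rangle$ a unit vector, $Q_{acc}\subseteq Q$, $T=((i_j,U_j(0),U_j(1)))_{j=1}^n$ with $(i_1,\dots,i_n)$ a permutation of $\{1,\dots,n\}$ and $U_j(b)$ unitary $d\times d$ matrices. On input $\sigma$ the final state is $|\psi^n\rangle=U_n(\sigma_{i_n})\cdots U_1(\sigma_{i_1})|\psi^0\rangle$ and the acceptance probability is $\|P_{acc}|\psi^n\rangle\|^2$ with $P_{acc}$ the projection onto the span of accepting basis states. An NUOBDD computes $f$ if for all $\sigma$: $f(\sigma)=1$ iff the acceptance probability is nonzero. Its width is $d$. *)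

(* Defs.v *)
From HB Require Import structures.
From mathcomp Require Import all_boot all_order all_fingroup all_algebra.
From mathcomp Require Import spectral complex reals.
Set Implicit Arguments.
Unset Strict Implicit.
Unset Printing Implicit Defensive.
Import Order.TTheory GRing.Theory Num.Theory.
Local Open Scope ring_scope.

(* Euclidean (Hermitian) norm of a column vector; its value is a nonnegative
   real number, seen as an element of C. *)
Definition vnorm (C : numClosedFieldType) (d : nat) (v : 'cV[C]_d) : C :=
  sqrtC (\sum_(i < d) `|v i 0| ^+ 2).

(* Basis states and levels are numbered from 0: the j-th level reads the
   variable [uobdd_var j]. There is no such object of width 0, for want of a
   unit vector. *)
Record uobdd (C : numClosedFieldType) (n d : nat) := UOBDD {
  uobdd_init : 'cV[C]_d;
  uobdd_init_unit : vnorm uobdd_init = 1;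
  uobdd_var : {perm 'I_n};
  uobdd_trans : 'I_n -> bool -> 'M[C]_d;
  uobdd_trans_unitary : forall j b, uobdd_trans j b \is unitarymx;
  uobdd_acc : {set 'I_d}
}.

Section Semantics.
Variables (C : numClosedFieldType) (n d : nat) (P : uobdd C n d).

(* [enum 'I_n] is increasing, so level 0 is applied to the initial vector
   first. *)
Definition final_state (s : n.-tuple bool) : 'cV[C]_d :=
  foldl (fun v j => uobdd_trans P j (tnth s (uobdd_var P j)) *m v)
        (uobdd_init P) (enum 'I_n).

Definition acc_proj : 'M[C]_d :=
  \matrix_(i, j) ((i == j) && (i \in uobdd_acc P))%:R.

Definition acc_prob (s : n.-tuple bool) : C :=
  vnorm (acc_proj *m final_state s) ^+ 2.

(* Nondeterministic acceptance. *)
Definition nuobdd_computes (f : n.-tuple bool -> bool) : Prop :=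
  forall s, f s = true <-> acc_prob s <> 0.

End Semantics.

(* Main.v *)
(** Take for [f] and [g] the divisibility of the Hamming weight by [c] and [d];
    a cyclic shift applied at each [1] counts modulo [c] in dimension [c], and
    the conjunction is divisibility by [m = lcm(c, d)].

    For the lower bound, cutting at a single level gives too little when [n] is
    close to [m]; instead one shows that the final states [z_i] on the words
    [1^i 0^(n-i)], [i < m], in reading order, are independent. In a nontrivial
    relation let [k] be the last index that occurs. All words involved end with
    [0^(n-k)], whose transition is invertible, so that this suffix can be
    replaced with [1^(m-k) 0^(n-m)] throughout. The word of index [i] then has
    weight [i + m - k], which lies strictly between [0] and [m] for [i < k] and
    equals [m] for [i = k]: projecting on the accepting states leaves only the
    [k]-th term, which is nonzero. *)
Require Import Defs.
From HB Require Import structures.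
From mathcomp Require Import all_boot all_order all_fingroup all_algebra.
From mathcomp Require Import spectral complex reals.
From mathcomp Require Import zify.
Import Order.TTheory GRing.Theory Num.Theory.
Set Implicit Arguments.
Unset Strict Implicit.

Local Open Scope ring_scope.

Definition weight n (s : n.-tuple bool) : nat := (\sum_(i < n) tnth s i)%N.

Lemma vnorm_sqr_eq0 (C : numClosedFieldType) d (v : 'cV[C]_d) :
  (vnorm v ^+ 2 == 0) = (v == 0).
Proof.
rewrite /vnorm sqrtCK psumr_eq0 => [|i _]; last exact: exprn_ge0.
apply/allP/eqP => [v0 | -> i _]; last by rewrite mxE normr0 expr0n eqxx.
apply/colP => i; rewrite mxE; apply/eqP.
by have := v0 i (mem_index_enum i); rewrite expf_eq0 normr_eq0.
Qed.

Lemma nuobdd_computesP (C : numClosedFieldType) n d (P : uobdd C n d) f :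
  nuobdd_computes P f <->
  forall s, f s = (acc_proj P *m final_state P s != 0).
Proof.
split=> Pf s.
  rewrite -vnorm_sqr_eq0; apply/idP/idP => [/Pf/eqP // | /eqP]; by case: (Pf s).
rewrite Pf -vnorm_sqr_eq0; split=> /eqP //.
Qed.

Section ModularCounter.
Variables (C : numClosedFieldType) (n c : nat).

Definition shift_mx : 'M[C]_c.+1 := \matrix_(i, j) (i == ordS j)%:R.

Lemma shift_mx_unitary : shift_mx \is unitarymx.
Proof.
apply/unitarymxP/matrixP => i k; rewrite !mxE (bigD1 (ord_pred i)) //=.
rewrite big1 => [|j ji]; last first.
  rewrite !mxE; case: eqP => [ij|_]; last by rewrite mul0r.
  by rewrite ij ordSK eqxx in ji.
by rewrite !mxE ord_predK eqxx mul1r addr0 rmorph_nat eq_sym.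
Qed.

Lemma counter_init_unit : vnorm (delta_mx 0 0 : 'cV[C]_c.+1) = 1.
Proof.
rewrite /vnorm (bigD1 0) //= big1 => [|i /negPf i0].
  by rewrite mxE !eqxx normr1 expr1n addr0 sqrtC1.
by rewrite mxE i0 normr0 expr0n.
Qed.

Definition counter_trans (_ : 'I_n) (b : bool) : 'M[C]_c.+1 :=
  if b then shift_mx else 1%:M.

Lemma counter_trans_unitary j b : counter_trans j b \is unitarymx.
Proof.
case: b; first exact: shift_mx_unitary.
by apply/unitarymxP; rewrite mul1mx trmx1 map_mx1.
Qed.

Definition counter : uobdd C n c.+1 :=
  UOBDD counter_init_unit 1%g counter_trans_unitary [set 0].

(** The start [a] is arbitrary for the sake of the induction: reading [b j] moves it to
    [a + b j]. *)
Lemma counter_run (b : 'I_n -> bool) r a :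
  foldl (fun v j => counter_trans j (b j) *m v)
        (delta_mx (inZp a) 0 : 'cV[C]_c.+1) r
  = delta_mx (inZp (a + \sum_(j <- r) b j)) 0.
Proof.
elim: r a => [|j r IHr] a /=; first by rewrite big_nil addn0.
rewrite big_cons addnA -IHr; congr foldl.
rewrite /counter_trans; case: (b j); last by rewrite mul1mx addn0.
apply/colP => i; rewrite mxE (bigD1 (inZp a)) //= big1 => [|k /negPf ka].
  rewrite !mxE !eqxx !andbT mulr1 addr0; congr (nat_of_bool (_ == _))%:R.
  by apply: val_inj; rewrite /= -addn1 modnDml.
by rewrite !mxE ka mulr0.
Qed.

Lemma counter_computes :
  nuobdd_computes counter (fun s => c.+1 %| weight s)%N.
Proof.
apply/nuobdd_computesP => s; rewrite /final_state.
have -> : uobdd_init counter = delta_mx (inZp 0) 0.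
  by congr delta_mx; apply: val_inj.
rewrite counter_run add0n big_enum /=.
under eq_bigr do rewrite perm1.
rewrite -/(weight s).
have -> : acc_proj counter *m delta_mx (inZp (weight s)) 0
       = (c.+1 %| weight s)%:R *: delta_mx 0 0 :> 'cV[C]_c.+1.
  apply/colP => i; rewrite mxE (bigD1 (inZp (weight s))) //=.
  rewrite big1 => [|k /negPf ks].
    rewrite !mxE !eqxx !andbT mulr1 addr0 inE.
    (* By computation: [inZp] reduces modulo [c.+1]. *)
    have -> : (c.+1 %| weight s)%N = (inZp (weight s) == 0 :> 'I_c.+1) by [].
    have [<- | neq_i] := eqVneq i (inZp (weight s)).
      by case: (i == 0); rewrite ?mulr1 ?mulr0.
    have [s0 | _] := eqVneq (inZp (weight s)) 0; last by rewrite mul0r.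
    by rewrite s0 in neq_i; rewrite (negPf neq_i) mulr0.
  by rewrite !mxE ks mulr0.
case: dvdn => /=; last by rewrite scale0r eqxx.
rewrite scale1r; apply/esym/eqP => /colP/(_ 0)/eqP.
by rewrite !mxE !eqxx oner_eq0.
Qed.

End ModularCounter.

Section LowerBound.
Variables (C : numClosedFieldType) (n w : nat) (P : uobdd C n w).

(* The final state on a word given in reading order rather than in the order
   of the variables. *)
Definition run (b : 'I_n -> bool) : 'cV[C]_w :=
  foldl (fun v j => uobdd_trans P j (b j) *m v) (uobdd_init P) (enum 'I_n).

(** The inverse permutation puts [b j] at the variable read at level [j]. As the weight is
    symmetric, the order of the variables then plays no part in the lower bound. *)
Definition read_tuple (b : 'I_n -> bool) : n.-tuple bool :=
  [tuple b ((uobdd_var P)^-1%g i) | i < n].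

Lemma final_state_read_tuple b : final_state P (read_tuple b) = run b.
Proof.
rewrite /final_state /run; elim: (enum _) (uobdd_init P) => //= j r IHr v.
by rewrite IHr tnth_mktuple permK.
Qed.

Lemma weight_read_tuple b : weight (read_tuple b) = (\sum_(j < n) b j)%N.
Proof.
rewrite /weight (reindex_inj (@perm_inj _ (uobdd_var P))) /=.
by apply: eq_bigr => j _; rewrite tnth_mktuple permK.
Qed.

Lemma foldl_trans (b : 'I_n -> bool) r :
  exists2 M : 'M[C]_w, M \in unitmx &
    forall v : 'cV_w, foldl (fun v j => uobdd_trans P j (b j) *m v) v r = M *m v.
Proof.
elim: r => [|j r [M Mu IHr]] /=.
  by exists 1%:M => [|v]; rewrite ?unitmx1 ?mul1mx.
exists (M *m uobdd_trans P j (b j)) => [|v]; last by rewrite IHr mulmxA.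
by rewrite unitmx_mul Mu unitarymx_unit ?uobdd_trans_unitary.
Qed.

Lemma eq_foldl_trans (b b' : 'I_n -> bool) (r : seq 'I_n) (v : 'cV_w) :
  {in r, b =1 b'} ->
  foldl (fun v j => uobdd_trans P j (b j) *m v) v r
  = foldl (fun v j => uobdd_trans P j (b' j) *m v) v r.
Proof.
elim: r v => //= j r IHr v bb'; rewrite bb' ?mem_head // IHr // => i ri.
by rewrite bb' // in_cons ri orbT.
Qed.

(** [M] undoes the suffix [e] and then reads [e']. It is chosen before [b] and [b'], so one matrix
    serves all prefixes and can be applied to a whole linear relation. *)
Lemma run_change_suffix k (e e' : 'I_n -> bool) :
  exists M : 'M[C]_w, forall b b' : 'I_n -> bool,
    (forall j : 'I_n, (j < k)%N -> b j = b' j) ->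
    (forall j : 'I_n, (k <= j)%N -> b j = e j) ->
    (forall j : 'I_n, (k <= j)%N -> b' j = e' j) ->
  run b' = M *m run b.
Proof.
have lt_k j : j \in take k (enum 'I_n) -> (j < k)%N.
  rewrite -(mem_map val_inj) map_take val_enum_ord take_iota mem_iota /=.
  lia.
have ge_k j : j \in drop k (enum 'I_n) -> (k <= j)%N.
  rewrite -(mem_map val_inj) map_drop val_enum_ord drop_iota mem_iota /=.
  lia.
have [M Mu MP] := foldl_trans e (drop k (enum 'I_n)).
have [M' _ MP'] := foldl_trans e' (drop k (enum 'I_n)).
exists (M' *m invmx M) => b b' pre be be'.
rewrite /run -(cat_take_drop k (enum 'I_n)) !foldl_cat -mulmxA.
rewrite (@eq_foldl_trans b b' (take _ _)) => [|j /lt_k/pre //].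
rewrite (@eq_foldl_trans b e (drop _ _)) => [|j /ge_k/be //].
rewrite (@eq_foldl_trans b' e' (drop _ _)) => [|j /ge_k/be' //].
by rewrite MP MP' mulKmx.
Qed.

(* [1^i 0^(k-i) 1^(m-k) 0^(n-m)] in reading order, for i <= k <= m <= n *)
Definition two_blocks m i k (j : 'I_n) := (j < i)%N || (k <= j < m)%N.

Lemma sum_two_blocks m i k : (i <= k <= m)%N -> (m <= n)%N ->
  (\sum_(j < n) two_blocks m i k j = i + (m - k))%N.
Proof.
move=> /andP[ik km] mn.
rewrite -(big_mkord xpredT (fun j => (j < i) || (k <= j < m) : nat)%N).
(* Cut at [i], [k] and [m]: the summand is constantly 1, 0, 1, 0 on the four pieces. *)
rewrite (big_cat_nat (n := i)) ?(leq_trans ik) ?(leq_trans km) //=.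
rewrite (big_cat_nat (n := k) (m := i)) ?(leq_trans km) //=.
rewrite (big_cat_nat (n := m) (m := k)) //=.
rewrite (eq_big_nat _ _ (F2 := fun=> 1%N)) => [|j jP]; last by lia.
rewrite (@eq_big_nat _ _ _ i k _ (fun=> 0%N)) => [|j jP]; last by lia.
rewrite (@eq_big_nat _ _ _ k m _ (fun=> 1%N)) => [|j jP]; last by lia.
rewrite (@eq_big_nat _ _ _ m n _ (fun=> 0%N)) => [|j jP]; last by lia.
by rewrite !sum_nat_const_nat; lia.
Qed.

Lemma modular_width m : (0 < m <= n)%N ->
  nuobdd_computes P (fun s => m %| weight s)%N -> (m <= w)%N.
Proof.
move=> /andP[m0 mn] /nuobdd_computesP Pf.
have runP i k : (i <= k <= m)%N ->
    (m %| i + (m - k))%N = (acc_proj P *m run (two_blocks m i k) != 0).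
  move=> ikm.
  rewrite -(sum_two_blocks ikm mn) -weight_read_tuple Pf.
  by rewrite final_state_read_tuple.
(* For [k = m] the second block is empty, so row [i] is the final state on [1^i 0^(n-i)]. *)
pose Z := \matrix_(i < m) (run (two_blocks m i m))^T.
suff : row_free Z.
  by rewrite -row_leq_rank => /leq_trans; apply; exact: rank_leq_col.
apply: inj_row_free => v vZ; apply/eqP; apply/negPn/negP => v_neq0.
have [i0 vi0] : exists i, v 0 i != 0.
  apply/existsP; apply: contraR v_neq0; rewrite negb_exists => /forallP v0.
  by apply/eqP/rowP => i; rewrite mxE; apply/eqP; rewrite -[_ == _]negbK v0.
have [k vk k_max] :=
  @arg_maxnP _ i0 (fun i => v 0 i != 0) (fun i : 'I_m => i) vi0.
(* Only levels from [k] on matter here: the suffix [0^(n-k)] becomes [1^(m-k) 0^(n-m)]. *)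
have [M MP] := run_change_suffix k (two_blocks m 0 m) (two_blocks m 0 k).
have {}MP (i : 'I_m) : (i <= k)%N ->
    run (two_blocks m i k) = M *m run (two_blocks m i m).
  by move=> ik; apply: MP => j jk; rewrite /two_blocks; have := ltn_ord k; lia.
(* Image of the relation [vZ] under [acc_proj P *m M], transposed since the states are the rows of
   [Z]. *)
have : \sum_(i < m) v 0 i *: (acc_proj P *m (M *m run (two_blocks m i m))) = 0.
  under eq_bigr do rewrite mulmxA scalemxAr.
  rewrite -mulmx_sumr; apply/trmx_inj; rewrite trmx_mul trmx0.
  suff -> : (\sum_(i < m) v 0 i *: run (two_blocks m i m))^T = 0 by rewrite mul0mx.
  rewrite -vZ mulmx_sum_row raddf_sum; apply: eq_bigr => i _ /=.
  by rewrite linearZ /= rowK.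
rewrite (bigD1 k) //= big1 => [|i ik]; last first.
  have [-> | /k_max le_ik] := eqVneq (v 0 i) 0; first by rewrite scale0r.
  have lt_ik : (i < k)%N by rewrite ltn_neqAle ik.
  rewrite -MP //; apply/eqP; rewrite scaler_eq0; apply/orP; right.
  apply: negbNE; rewrite -runP; last by have := ltn_ord k; lia.
  (* The weight [i + (m - k)] is positive even for [i = 0], because [k < m]. *)
  by rewrite gtnNdvd //; have := ltn_ord k; lia.
rewrite addr0 -MP //; apply/eqP; rewrite scaler_eq0 negb_or vk -runP.
  by rewrite subnKC ?dvdnn // ltnW.
by rewrite leqnn ltnW.
Qed.

End LowerBound.
Local Close Scope ring_scope.
Unset Implicit Arguments.
Set Strict Implicit.

Theorem theorem16 (R : realType) (n c d : nat) (hc : 0 < c) (hd : 0 < d)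
    (hn : lcmn c d <= n) :
  exists f g : n.-tuple bool -> bool,
    [/\ exists P : uobdd R[i] n c, nuobdd_computes P f,
        exists P : uobdd R[i] n d, nuobdd_computes P g
      & forall (w : nat) (P : uobdd R[i] n w),
          nuobdd_computes P (fun s => f s && g s) -> lcmn c d <= w].
Proof.
exists (fun s => c %| weight s), (fun s => d %| weight s).
case: c d hc hd hn => [|c'] [|d'] // _ _ hn; split.
- by exists (counter _ n c'); exact: counter_computes.
- by exists (counter _ n d'); exact: counter_computes.
move=> w P Pfg; apply: (@modular_width _ n w P); first by rewrite lcmn_gt0.
by move=> s; rewrite dvdn_lcm.
Qed.
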